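(* Let $d\ge 1$ and let $G$ be a finite graph of maximum degree $d$. Then $$\frac{1}{6d^2}\cdot \mathrm{tw}(G)\;\le\;\mathrm{boolw}(G)\;\le\;\mathrm{tw}(G)+1 .$$
   Context: Graphs are undirected and without loops. $\mathrm{tw}(G)$ denotes the treewidth of $G$. For a vertex subset $A\subseteq V(G)$ let $\overline{A}=V(G)\setminus A$, and for $X\subseteq A$ consider the set $N(X)\cap\overline{A}$ of vertices of $\overline{A}$ having at least one neighbor in $X$. Define $$\mathrm{cutbool}(A)=\log_2\left|\{N(X)\cap\overline{A} : X\subseteq A\}\right| ,$$ which is known to be symmetric: $\mathrm{cutbool}(A)=\mathrm{cutbool}(\overline{A})$. A decomposition tree of $G$ is a pair $(T,\delta)$ where $T$ is a tree whose internal nodes all have degree three and which has $|V(G)|$ leaves, and $\delta$ is a bijection between $V(G)$ and the leaves of $T$. Each edge of $T$ defines a cut $\{A,\overline{A}\}$ of $G$: the two parts are the vertices corresponding to the leaves of the two subtrees obtained by removing the edge. The boolean-width $\mathrm{boolw}(T,\delta)$ of the decomposition tree is the maximum of $\mathrm{cutbool}(A)$ over all cuts $\{A,\overline{A}\}$ given by edges of $T$. The boolean-width $\mathrm{boolw}(G)$ is the minimum of $\mathrm{boolw}(T,\delta)$ over all decomposition trees of $G$. *)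

(* Defs.v *)
From mathcomp Require Import all_boot all_order all_algebra.
From mathcomp Require Import boolp classical_sets reals exp.

Set Implicit Arguments.
Unset Strict Implicit.
Unset Printing Implicit Defensive.

Import Order.TTheory GRing.Theory Num.Theory.

Record sgraph := SGraph {
  svertex :> finType;
  sedge : rel svertex;
  sg_sym : symmetric sedge;
  sg_irrefl : irreflexive sedge
}.

Notation "x -- y" := (sedge x y) (at level 30, no associativity).

Definition deg (G : sgraph) (x : G) : nat := #|[pred y | x -- y]|.

Definition max_degree (G : sgraph) : nat := \max_(x : G) deg x.

(* In a simple graph the sequences of size at least 3 among the [ucycle]s are
   exactly the graph cycles: [:: x; y] with x -- y is a [ucycle] of size 2. *)
Definition is_tree (T : sgraph) : Prop :=
  [/\ 0 < #|T|,
      forall x y : T, connect (@sedge T) x y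
    & forall c : seq T, ucycle (@sedge T) c -> size c <= 2].

Definition tree_decomp (G T : sgraph) (B : T -> {set G}) : Prop :=
  [/\ is_tree T,
      forall v : G, exists t, v \in B t,
      forall u v : G, u -- v -> exists t, (u \in B t) && (v \in B t)
    & forall (v : G) (s t : T), v \in B s -> v \in B t ->
        connect [rel x y | [&& x -- y, v \in B x & v \in B y]] s t].

(* The predecessor is truncated, but this only matters for the graph without
   vertices, which gets width 0. *)
Definition tree_decomp_width (G T : sgraph) (B : T -> {set G}) : nat :=
  (\max_(t : T) #|B t|).-1.

Definition has_tree_decomp (G : sgraph) (k : nat) : Prop :=
  exists (T : sgraph) (B : T -> {set G}),
    tree_decomp B /\ tree_decomp_width B = k.

Lemma has_tree_decomp_ex (G : sgraph) : exists k, `[< has_tree_decomp G k >].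
Proof.
have sT : symmetric (fun _ _ : unit => false) by [].
pose B (_ : SGraph sT (fun=> erefl)) := [set: G]%SET.
exists (tree_decomp_width B); apply/asboolP.
exists (SGraph sT (fun=> erefl)), B; split=> //; split.
- split; first by rewrite card_unit.
  + by move=> [] []; exact: connect0.
  + case=> [|[] [|[] c]] //.
- by move=> v; exists tt; rewrite inE.
- by move=> u v _; exists tt; rewrite !inE.
- by move=> v [] [] _ _; exact: connect0.
Qed.

Definition tw (G : sgraph) : nat := ex_minn (has_tree_decomp_ex G).

Local Open Scope ring_scope.

Definition log2 (R : realType) (x : R) : R := ln x / ln 2.

Definition nbhd (G : sgraph) (X : {set G}) : {set G} :=
  [set y | [exists x in X, x -- y]]%SET.

Definition cutbool (R : realType) (G : sgraph) (A : {set G}) : R :=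
  log2 #|[set nbhd X :&: ~: A | X in powerset A]%SET|%:R.

(* Degree 0 occurs in a tree only for the tree with a single node, which is the
   decomposition tree of a graph with a single vertex. *)
Definition is_leaf (T : sgraph) (t : T) : bool := (deg t <= 1)%N.

Definition decomposition_tree (G T : sgraph) (delta : G -> T) : Prop :=
  [/\ is_tree T,
      forall t : T, ~~ is_leaf t -> deg t = 3%N,
      injective delta
    & [set delta v | v : G]%SET = [set t | is_leaf t]%SET].

Definition del_edge (T : sgraph) (s t : T) : rel T :=
  [rel x y | x -- y && ((x, y) \notin [:: (s, t); (t, s)])].

(* The part on the side of s of the cut given by the edge s -- t; the other
   part is [cut_side delta t s]. *)
Definition cut_side (G T : sgraph) (delta : G -> T) (s t : T) : {set G} :=
  [set v | connect (del_edge s t) s (delta v)]%SET.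

(* Both orientations of every edge are included, which leaves the maximum
   unchanged since [cutbool] is symmetric. The default value 0 of the maximum is
   harmless since [cutbool] is nonnegative. *)
Definition boolw_tree (R : realType) (G T : sgraph) (delta : G -> T) : R :=
  \big[Num.max/0]_(st : T * T | st.1 -- st.2)
     cutbool R (cut_side delta st.1 st.2).

Definition boolw_values (R : realType) (G : sgraph) : set R :=
  [set w | exists (T : sgraph) (delta : G -> T),
     decomposition_tree delta /\ boolw_tree R delta = w]%classic.
Arguments boolw_values : clear implicits.

(* A graph with a vertex has a decomposition tree, and then the infimum is a
   minimum, see [boolw_attained]. *)
Definition boolw (R : realType) (G : sgraph) : R := inf (boolw_values R G).

Lemma boolw_valuesP (R : realType) (G : sgraph) (w : R) :
  boolw_values R G w -> exists i : 'I_(2 ^ #|G|).+1, w = log2 i%:R.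
Proof.
case=> T [delta [_ <-]]; rewrite /boolw_tree.
elim/big_ind: _ => [|x y [i ->] [j ->]|st _].
- by exists ord0; rewrite /log2 ln0 // mul0r.
- by rewrite /Num.max; case: ifP => _; [exists j | exists i].
- set A := cut_side _ _ _.
  have cardA : (#|[set nbhd X :&: ~: A | X in powerset A]%SET| < (2 ^ #|G|).+1)%N.
    rewrite ltnS (leq_trans (leq_imset_card _ _)) // card_powerset.
    by rewrite leq_exp2l // max_card.
  by exists (Ordinal cardA).
Qed.

Lemma boolw_attained (R : realType) (G : sgraph) :
  (boolw_values R G !=set0)%classic ->
  boolw_values R G (boolw R G) /\
  forall w, boolw_values R G w -> boolw R G <= w.
Proof.
move=> [w0 Sw0]; have [i0 w0E] := boolw_valuesP Sw0.
pose f (i : 'I_(2 ^ #|G|).+1) : R := log2 i%:R.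
pose P (i : 'I_(2 ^ #|G|).+1) := `[< boolw_values R G (f i) >].
have P0 : P i0 by apply/asboolP; rewrite /f -w0E.
case: (@arg_minP _ _ _ i0 P f P0) => i /asboolP Pi imin.
have lbi w : boolw_values R G w -> f i <= w.
  move=> Sw; have [j wE] := boolw_valuesP Sw.
  by rewrite wE; apply: imin; apply/asboolP; rewrite /f -wE.
have -> : boolw R G = f i; last by split.
apply/eqP; rewrite eq_le; apply/andP; split.
- by apply: ge_inf => //; exists (f i) => w /lbi.
- by apply: lb_le_inf; [exists w0 | move=> w /lbi].
Qed.

(* Main.v *)
Require Import Defs.
From mathcomp Require Import all_boot all_order all_algebra.
From mathcomp Require Import boolp reals exp.
From mathcomp Require Import ring lra.

(** Both inequalities turn a decomposition of one kind into one of the other.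

    Lower bound. Given a decomposition tree, put a vertex v of G in the bag of
    every tree node lying on a path from the leaf of v to the leaf of a neighbour
    of v. Each vertex then occupies a union of paths that share a node, and the
    two ends of an edge share a whole path, so this is a tree decomposition
    ([path_bag_tree_decomp]). The vertices in the bag of a node, apart from one
    mapped to that node, lie on the boundary of one of its at most three cuts,
    on one side or the other ([card_path_bag_le]). A boundary of a side A has at
    most d^2 k vertices, where k is the size of a maximal set X of boundary
    vertices with pairwise disjoint neighbourhoods across the cut: every other
    boundary vertex is within distance two of X. The subsets of X have 2^k
    distinct neighbourhoods across the cut, so k is at most the cut-boolean
    value of A ([boundary_le_cutbool]). Three cuts with two sides each give the
    factor 6 d^2, and the vertex mapped to the node is absorbed by the -1 in
    the definition of the width.

    Upper bound. If a set C meets all edges across a cut, the cut has at most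
    2^|C| neighbourhoods ([cutbool_le_cover]). Hence it is enough to find a
    decomposition tree all of whose cuts are covered by bags of an optimal tree
    decomposition, each of which has at most tw(G) + 1 vertices. A set with at
    least two vertices whose cut is covered by a bag splits into two smaller sets
    of the same kind ([bag_covered_split]). Starting from the split of the vertex
    set into one vertex and the rest, repeated splitting grows a tree with cubic
    inner nodes by hanging two new leaves on a leaf, until each leaf carries one
    vertex ([decomposition_tree_exists]). *)

Set Implicit Arguments.
Unset Strict Implicit.
Unset Printing Implicit Defensive.

Import Order.TTheory GRing.Theory Num.Theory.

(** * Edges of a tree as bridges *)

Section Trees.
Variable T : sgraph.
Implicit Types s t x y : T.

Lemma del_edgeE s t x y :
  del_edge s t x y =
  x -- y && ~~ ((x == s) && (y == t) || (x == t) && (y == s)).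
Proof. by rewrite /del_edge /= !inE !xpair_eqE. Qed.

Lemma del_edgeC s t : del_edge s t =2 del_edge t s.
Proof. by move=> x y; rewrite !del_edgeE orbC. Qed.

Lemma connect_del_edgeC s t x y :
  connect (del_edge s t) x y = connect (del_edge t s) x y.
Proof. exact: eq_connect (del_edgeC s t) x y. Qed.

Lemma del_edge_sym s t : symmetric (del_edge s t).
Proof. by move=> x y; rewrite !del_edgeE sg_sym orbC ![(x == _) && _]andbC. Qed.

Lemma connect_del_edge_sym s t : connect_sym (del_edge s t).
Proof. exact/sym_connect_sym/del_edge_sym. Qed.

Lemma sedge_neq x y : x -- y -> x != y.
Proof. by move=> xy; apply/eqP => e; move: xy; rewrite e sg_irrefl. Qed.

Lemma path_avoid_del_edge s t x p :
  path (@sedge T) x p -> s \notin x :: p ->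
  connect (del_edge s t) x (last x p).
Proof.
elim: p x => [|y p IHp] x /=; first by [].
move=> /andP[xy yp]; rewrite inE negb_or => /andP[sx sp].
apply: connect_trans (IHp y yp sp); apply: connect1; rewrite del_edgeE.
move: sp; rewrite inE negb_or => /andP[sy _].
by rewrite xy (eq_sym x s) (eq_sym y s) (negPf sx) (negPf sy) andbF.
Qed.

Hypothesis treeT : is_tree T.

Lemma uniq_pathP x y :
  exists2 p, path (@sedge T) x p /\ uniq (x :: p) & last x p = y.
Proof.
case: treeT => _ conT _; have /connectP[p xp ->] := conT x y.
by case/shortenP: xp => q xq uq _; exists q.
Qed.

(** A path around the edge would close up with it to a cycle of length at
    least three. *)
Lemma tree_edge_bridge s t : s -- t -> ~~ connect (del_edge s t) s t.
Proof.
case: treeT => _ _ acyc st; apply/negP => /connectP[p0 sp0 tE].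
case/shortenP: sp0 tE => p sp up _ tE.
have spT : path (@sedge T) s p by apply: sub_path sp => x y /andP[].
have: ucycle (@sedge T) (s :: p).
  by rewrite /ucycle /ucycleb up andbT /= rcons_path spT -tE sg_sym.
move=> /acyc; case: p sp {up spT} tE => [|y [|z p]] //= sp tE _.
- by move: (sedge_neq st); rewrite tE eqxx.
- by move: sp; rewrite tE /= andbT del_edgeE !eqxx andbF.
Qed.

Lemma connect_edge_side s t x :
  connect (del_edge s t) s x \/ connect (del_edge s t) t x.
Proof.
case: treeT => _ conT _; have /connectP[p sp ->] := conT s x.
elim/last_ind: p sp => [|p y IHp]; first by left.
rewrite rcons_path last_rcons => /andP[/IHp IH zy].
have [zye|] := boolP (del_edge s t (last s p) y).
  by case: IH => IH; [left|right]; apply: connect_trans IH (connect1 zye).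
rewrite del_edgeE zy /= negbK => /orP[] /andP[_ /eqP->].
- by right.
- by left.
Qed.

(** The edge entering b is crossed only once, so the rest of the path joins
    each end of the path to a different end of this bridge. *)
Lemma uniq_path_edge_separates x p1 b p2 :
  path (@sedge T) x (p1 ++ b :: p2) -> uniq (x :: p1 ++ b :: p2) ->
  ~~ connect (del_edge (last x p1) b) x (last b p2).
Proof.
rewrite cat_path -cat_cons cat_uniq => /andP[xp1 /= /andP[ab bp2]].
move=> /and3P[_ /norP[bNp1 p2Np1] /andP[bp2N up2]].
apply/negP => xy; move/negP: (tree_edge_bridge ab); apply.
have xa : connect (del_edge (last x p1) b) x (last x p1).
  by rewrite connect_del_edgeC; apply: path_avoid_del_edge.
have bY : connect (del_edge (last x p1) b) b (last b p2).
  apply: path_avoid_del_edge => //; rewrite inE negb_or sedge_neq //=.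
  by apply: contra p2Np1 => ap2; apply/hasP; exists (last x p1); rewrite ?mem_last.
rewrite connect_del_edge_sym in xa.
rewrite connect_del_edge_sym in bY.
exact: connect_trans xa (connect_trans xy bY).
Qed.

End Trees.

(** * Boundaries and covers of a cut *)

Lemma card_bigcup_le (I T : finType) (P : pred I) (F : I -> {set T}) m :
  (forall i, P i -> #|F i| <= m) -> #|\bigcup_(i | P i) F i| <= #|P| * m.
Proof.
move=> Fm; rewrite -sum_nat_const.
elim/big_ind2: _ => [|a n b p an bp|i Pi]; rewrite ?cards0 ?Fm //.
by apply: leq_trans (leq_card_setU _ _) _; apply: leq_add.
Qed.

Section Cuts.
Variable G : sgraph.
Implicit Types A C X Y : {set G}.

Definition boundary A : {set G} := [set v in A | [exists u, (u \notin A) && (v -- u)]].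

Definition cut_nbhds A : {set {set G}} := [set nbhd X :&: ~: A | X in powerset A].

Definition covers_cut C A :=
  forall u v, u \in A -> v \notin A -> u -- v -> (u \in C) || (v \in C).

Lemma covers_cutC C A : covers_cut C A -> covers_cut C (~: A).
Proof.
move=> cov u v; rewrite !inE negbK => uA vA uv.
by rewrite orbC; apply: cov; rewrite // sg_sym.
Qed.

(** The neighbourhood of X across the cut is determined by the trace of X on C
    and by the part within C of the neighbourhood of X outside C. These two parts
    of C lie on opposite sides of the cut, so their union, a subset of C, still
    encodes both. *)
Lemma card_cut_nbhds_le A C : covers_cut C A -> #|cut_nbhds A| <= 2 ^ #|C|.
Proof.
move=> cov; rewrite -card_powerset.
pose code X := (X :&: C) :|: (nbhd (X :\: C) :&: ~: A :&: C).
pose decode Y := (nbhd (Y :&: A) :&: ~: A) :|: (Y :\: A).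
have sub : cut_nbhds A \subset decode @: powerset C.
  apply/fintype.subsetP => Z /imsetP[X]; rewrite powersetE => /fintype.subsetP XA ->.
  apply/imsetP; exists (code X).
    by rewrite powersetE subUset !subsetIr.
  apply/setP => y; rewrite !inE.
  have [yA|yA] /= := boolP (y \in A); first by rewrite !andbF.
  rewrite !andbT; apply/existsP/orP.
  - move=> [x /andP[xX xy]]; have [xC|xC] := boolP (x \in C).
      by left; apply/existsP; exists x; rewrite !inE xX xC XA.
    have yC : y \in C.
      by have := cov x y (XA x xX) yA xy; rewrite (negPf xC).
    right; apply/orP; right; rewrite yC andbT.
    by apply/existsP; exists x; rewrite !inE xC xX.
  - case=> [/existsP[x]|/orP[/andP[yX _]|/andP[/existsP[x]]]].
    + rewrite !inE => /andP[/andP[/orP[/andP[xX _]|]]].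
        by move=> _ xy; exists x; rewrite xX.
      by rewrite (andbC _ (~~ _)) -andbA => /andP[/negPf-> _].
    + by rewrite XA in yA.
    + by rewrite !inE => /andP[/andP[_ xX] xy] _; exists x; rewrite xX.
exact: leq_trans (subset_leq_card sub) (leq_imset_card _ _).
Qed.

(** Here k is the size of a maximal set X of boundary vertices with pairwise
    disjoint neighbourhoods outside A. By maximality every boundary vertex has a
    neighbour in common with a vertex of X, and there are at most d^2 walks of
    length two from a given vertex. Distinct subsets of X have distinct
    neighbourhoods outside A, as the neighbours of a vertex of X outside A are
    adjacent to no other vertex of X. *)
Lemma card_boundary_le A d :
  (forall x : G, deg x <= d) ->
  exists2 k, #|boundary A| <= d ^ 2 * k & 2 ^ k <= #|cut_nbhds A|.
Proof.
move=> degG.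
pose indep X := (X \subset boundary A) &&
  [forall x in X, forall y in X, forall u,
     (u \notin A) && (x -- u) && (y -- u) ==> (x == y)].
have ind0 : indep set0.
  by rewrite /indep sub0set; apply/forall_inP => x; rewrite inE.
have [X maxX _] := maxset_exists ind0.
have /andP[/fintype.subsetP Xb /forall_inP disj] := maxsetp maxX.
have disjE x y u : x \in X -> y \in X -> u \notin A -> x -- u -> y -- u -> x = y.
  move=> xX yX uA xu yu; have /forall_inP/(_ y yX)/forallP/(_ u) := disj x xX.
  by rewrite uA xu yu => /eqP.
have XA x : x \in X -> x \in A by move/Xb; rewrite inE => /andP[].
exists #|X|.
- have sub : boundary A \subset \bigcup_(x in X) \bigcup_(u | x -- u) [set v | u -- v].
    apply/fintype.subsetP => v vb.
    have [u uA vu] : exists2 u, u \notin A & v -- u.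
      by move: vb; rewrite inE => /andP[_ /existsP[u /andP[]]]; exists u.
    have [vX|vX] := boolP (v \in X).
      apply/bigcupP; exists v => //; apply/bigcupP; exists u => //.
      by rewrite inE sg_sym.
    have [|] := boolP [exists x in X, [exists w, [&& w \notin A, x -- w & v -- w]]].
      case/exists_inP => x xX /existsP[w /and3P[_ xw vw]].
      apply/bigcupP; exists x => //; apply/bigcupP; exists w => //.
      by rewrite inE sg_sym.
    move=> noconf; suff /(maxsetsup maxX) E : indep (v |: X).
      by rewrite -E ?subsetUr ?setU11 in vX.
    have nc x w : x \in X -> w \notin A -> x -- w -> v -- w -> false.
      move=> xX wA xw vw; move/negP: noconf => [].
      by apply/exists_inP; exists x => //; apply/existsP; exists w; apply/and3P.
    apply/andP; split.
      by rewrite subUset sub1set vb /=; apply/fintype.subsetP.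
    apply/forall_inP => x xX; apply/forall_inP => y yX; apply/forallP => w.
    apply/implyP => /andP[/andP[wA xw] yw].
    move: xX yX; rewrite !inE => /orP[/eqP xE|xX] /orP[/eqP yE|yX].
    + by rewrite xE yE.
    + by rewrite xE in xw; have := nc y w yX wA yw xw.
    + by rewrite yE in yw; have := nc x w xX wA xw yw.
    + by apply/eqP; exact: disjE wA xw yw.
  apply: leq_trans (subset_leq_card sub) _.
  rewrite mulnC; apply: card_bigcup_le => x _.
  apply: leq_trans (card_bigcup_le (m := d) _) _; last by rewrite leq_mul2r degG orbT.
  by move=> u _; rewrite cardsE; apply: degG.
- rewrite -card_powerset.
  suff inj : {in powerset X &, injective (fun Y => nbhd Y :&: ~: A)}.
    rewrite -(card_in_imset inj); apply: subset_leq_card.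
    apply/fintype.subsetP => _ /imsetP[Y YX ->]; apply: imset_f.
    move: YX; rewrite !powersetE => /fintype.subsetP YX.
    by apply/fintype.subsetP => y /YX/XA.
  have half Y Z : Y \in powerset X -> Z \in powerset X ->
      nbhd Y :&: ~: A = nbhd Z :&: ~: A -> Y \subset Z.
    rewrite !powersetE => /fintype.subsetP YX /fintype.subsetP ZX E.
    apply/fintype.subsetP => x xY.
    have := Xb _ (YX x xY); rewrite inE => /andP[_ /existsP[u /andP[uA xu]]].
    have : u \in nbhd Y :&: ~: A.
      by rewrite !inE uA andbT; apply/existsP; exists x; rewrite xY.
    rewrite E !inE => /andP[/existsP[z /andP[zZ zu]] _].
    by rewrite (disjE x z u (YX x xY) (ZX z zZ) uA xu zu).
  by move=> Y Z YX ZX E; apply/eqP; rewrite eqEsubset !half.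
Qed.

End Cuts.

Section CutboolBounds.
Local Open Scope ring_scope.
Variables (R : realType) (G : sgraph).
Implicit Types A C : {set G}.

Lemma ln2_gt0 : 0 < ln 2 :> R.
Proof. by rewrite ln_gt0 // ltr1n. Qed.

Lemma log2_exp2 k : log2 (2 ^ k)%:R = k%:R :> R.
Proof.
by rewrite /log2 natrX lnXn // -[X in X / _]mulr_natl mulfK // gt_eqF // ln2_gt0.
Qed.

Lemma le_log2_nat m n : (0 < m)%N -> (m <= n)%N -> log2 m%:R <= log2 n%:R :> R.
Proof.
move=> m0 mn; rewrite /log2 ler_pM2r ?invr_gt0 ?ln2_gt0 //.
by rewrite ler_ln ?posrE ?ltr0n ?ler_nat // (leq_trans m0).
Qed.

Lemma card_cut_nbhds_gt0 A : (0 < #|cut_nbhds A|)%N.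
Proof.
rewrite card_gt0; apply/set0Pn; exists (nbhd set0 :&: ~: A)%SET.
by apply: imset_f; rewrite powersetE sub0set.
Qed.

Lemma cutbool_le_cover A C : covers_cut C A -> cutbool R A <= #|C|%:R.
Proof.
move=> cov; rewrite -log2_exp2.
exact: le_log2_nat (card_cut_nbhds_gt0 A) (card_cut_nbhds_le cov).
Qed.

Lemma boundary_le_cutbool A d :
  (forall x : G, deg x <= d)%N -> #|boundary A|%:R <= d%:R ^+ 2 * cutbool R A.
Proof.
move=> degG; have [k bk kA] := card_boundary_le A degG.
apply: (@le_trans _ _ (d%:R ^+ 2 * k%:R)); first by rewrite -natrX -natrM ler_nat.
rewrite ler_wpM2l ?exprn_ge0 // -log2_exp2.
by apply: le_log2_nat; rewrite ?expn_gt0.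
Qed.

End CutboolBounds.

(** * Growing a decomposition tree *)

Lemma homo_connect (S T : finType) (e : rel S) (e' : rel T) (f : S -> T) :
  (forall x y, e x y -> connect e' (f x) (f y)) ->
  forall x y, connect e x y -> connect e' (f x) (f y).
Proof.
move=> ef x y /connectP[p + ->]; elim: p x => [|z p IHp] x //= /andP[/ef xz zp].
exact: connect_trans xz (IHp z zp).
Qed.

Lemma cut_sideC (G T : sgraph) (delta : G -> T) (s t : T) :
  is_tree T -> s -- t -> cut_side delta t s = ~: cut_side delta s t.
Proof.
move=> treeT st; apply/setP => v; rewrite !inE connect_del_edgeC.
apply/idP/negP => [tv sv|sv]; last by case: (connect_edge_side treeT s t (delta v)).
apply: (negP (tree_edge_bridge treeT st)); apply: connect_trans sv _.
by rewrite connect_del_edge_sym.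
Qed.

(** Hanging a new vertex [None] on the vertex [t] of [T]. The new vertex is
    retracted to [t]; the old edges cut a set mapped to the new tree exactly as
    they cut its retraction, and the new edge cuts off the fibre of [None]. *)
Section Pendant.
Variables (T : sgraph) (t : T).

Definition pendant_rel (x y : option T) : bool :=
  match x, y with
  | Some a, Some b => a -- b
  | Some a, None | None, Some a => a == t
  | None, None => false
  end.

Lemma pendant_rel_sym : symmetric pendant_rel.
Proof. by case=> [a|] [b|] //=; rewrite sg_sym. Qed.

Lemma pendant_rel_irrefl : irreflexive pendant_rel.
Proof. by case=> [a|] //=; rewrite sg_irrefl. Qed.

Definition pendant : sgraph := SGraph pendant_rel_sym pendant_rel_irrefl.

Definition retract (x : pendant) : T := odflt t x.

Lemma pendant_tree : is_tree T -> is_tree pendant.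
Proof.
case=> _ conT acyc; split.
- by rewrite card_option.
- have con x : connect (@sedge pendant) (Some t) x.
    case: x => [x|]; last by apply: connect1 => /=.
    apply: (@homo_connect _ _ (@sedge T) _ Some) (conT t x) => a b ab.
    exact: connect1.
  move=> x y; apply: connect_trans (con y).
  by rewrite (sym_connect_sym (@sg_sym pendant)).
(* A cycle through None enters and leaves it by t; all others are cycles of T. *)
- move=> c ucyc; have [cN|cN] := boolP ((None : pendant) \in c).
    case: (rot_to cN) => i [|y c'] E.
      by rewrite -(size_rot i) E.
    have : ucycle (@sedge pendant) (rot i c) by rewrite rot_ucycle.
    rewrite -(size_rot i) E; case/lastP: c' E => [|c' z] // E.
    rewrite /ucycle /ucycleb /= !rcons_path last_rcons.
    case: y E => [y|] //= E /andP[/andP[/eqP-> /andP[_ zt]]].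
    case: z zt E => [z|] //= /eqP-> E /andP[_ /andP[]].
    by rewrite mem_rcons inE eqxx.
  have [c' cE] : exists c' : seq T, c = map Some c'.
    elim: c cN {ucyc} => [|[x|] c IHc] //=; first by exists [::].
    by rewrite inE => /IHc[c' ->]; exists (x :: c').
  rewrite cE size_map; apply: acyc; move: ucyc.
  rewrite cE /ucycle /ucycleb (map_inj_uniq (@Some_inj _)) => /andP[cyc ->].
  rewrite andbT; case: c' cyc {cE cN} => //= x c'.
  by rewrite -map_rcons path_map.
Qed.

Lemma deg_pendant_None : deg (None : pendant) = 1.
Proof.
rewrite /deg -(card1 (Some t : pendant)); apply: eq_card => -[x|] //.
Qed.

Lemma deg_pendant_Some (x : T) : deg (Some x : pendant) = deg x + (x == t).
Proof.
rewrite /deg (cardD1 (None : pendant)) addnC; congr (_ + _)%N.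
rewrite -[RHS](card_image (@Some_inj _)); apply: eq_card => -[y|].
  by rewrite (mem_image (@Some_inj _)).
by apply/esym/negbTE/negP => /imageP[].
Qed.

Lemma connect_pendant_old (s s' : T) (x : pendant) :
  connect (@del_edge pendant (Some s) (Some s')) (Some s) x =
  connect (del_edge s s') s (retract x).
Proof.
apply/idP/idP.
- apply: (@homo_connect _ _ _ _ retract) => a b; rewrite del_edgeE.
  case: a b => [a|] [b|] //= => [ab|/andP[/eqP-> _]|/andP[/eqP-> _]] //.
  by apply: connect1; rewrite del_edgeE.
- move=> sx; apply: (@connect_trans _ _ (Some (retract x))).
    apply: homo_connect sx => a b ab; apply: connect1.
    by rewrite del_edgeE /=; move: ab; rewrite del_edgeE.
  case: x {sx} => [x|] //=; apply: connect1.
  by rewrite del_edgeE /= eqxx !andbF.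
Qed.

Lemma connect_pendant_new (x : pendant) :
  connect (@del_edge pendant None (Some t)) None x = (x == None).
Proof.
apply/idP/eqP => [/connectP[[|y p] /=]|->] //.
rewrite del_edgeE eqxx /=; case: y => [y|] //=.
by case: eqP => [->|] //=; rewrite eqxx.
Qed.

Lemma pendant_cuts (G : sgraph) (delta : G -> pendant) (Q : {set G} -> Prop) :
  is_tree T -> (forall A, Q A -> Q (~: A)) ->
  (forall s s' : T, s -- s' -> Q (cut_side (retract \o delta) s s')) ->
  Q [set v | delta v == None] ->
  forall x y : pendant, x -- y -> Q (cut_side delta x y).
Proof.
move=> treeT Qc Qold Qnew.
have Qn : Q (cut_side delta None (Some t)).
  by congr (Q _): Qnew; apply/setP => v; rewrite !inE connect_pendant_new.
case=> [x|] [y|] // xy.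
- congr (Q _): (Qold x y xy); apply/setP => v.
  by rewrite !inE connect_pendant_old.
- have xt : x = t by exact/eqP.
  rewrite xt (@cut_sideC _ pendant _ None); first exact: Qc.
    exact: pendant_tree.
  by rewrite /= eqxx.
- by have -> : y = t by exact/eqP.
Qed.

End Pendant.

Section GrowTree.
Variables (G : sgraph) (Q : {set G} -> Prop).
Hypothesis QC : forall A, Q A -> Q (~: A).
Hypothesis Qsplit : forall A, Q A -> 1 < #|A| ->
  exists A1 : {set G}, [/\ A1 != set0, A1 \proper A, Q A1 & Q (A :\: A1)].

(** A decomposition tree in which a leaf may carry several vertices of G. Asking
    for the inner nodes to be exactly the nodes outside the image of [delta]
    fixes all degrees, and keeps every leaf nonempty. The condition on fibres
    makes [Qsplit] applicable at each leaf. *)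
Definition partial_decomposition (T : sgraph) (delta : G -> T) : Prop :=
  [/\ is_tree T,
      forall x, deg x = if x \in codom delta then 1 else 3,
      forall x y, x -- y -> Q (cut_side delta x y)
    & forall x, x \in codom delta -> Q [set v | delta v == x]].

Lemma partial_decomposition_start v0 :
  Q [set v0] -> 1 < #|G| ->
  exists (T : sgraph) (delta : G -> T), partial_decomposition delta.
Proof.
move=> Qv0 G2; have sT : symmetric (fun _ _ : unit => false) by [].
pose U := SGraph sT (fun=> erefl).
pose delta v : pendant (tt : U) := if v == v0 then None else Some tt.
exists (pendant (tt : U)), delta.
have treeU : is_tree U.
  split; first by rewrite card_unit.
  - by move=> [] []; exact: connect0.
  - by case=> [|[] [|[] c]].
have fibN : [set v | delta v == None] = [set v0].
  by apply/setP => v; rewrite !inE /delta; case: (v == v0).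
have [v1 v1v0] : exists v1, v1 != v0.
  have /card_gt0P[v1] : 0 < #|[set~ v0]| by rewrite cardsC1 -subn1 subn_gt0.
  by rewrite !inE; exists v1.
have all_codom x : x \in codom delta.
  apply/codomP; case: x => [[]|].
  - by exists v1; rewrite /delta (negPf v1v0).
  - by exists v0; rewrite /delta eqxx.
split.
- exact: pendant_tree.
- move=> x; rewrite all_codom; case: x => [[]|]; last exact: deg_pendant_None.
  by rewrite deg_pendant_Some eqxx /deg eq_card0.
- by apply: pendant_cuts => //; rewrite fibN.
- case=> [[]|] _; last by rewrite fibN.
  congr (Q _): (QC Qv0); apply/setP => v; rewrite !inE /delta.
  by case: (v == v0).
Qed.

(** Splitting the fibre F of the leaf x into A and F minus A, two pendant
    vertices hung on x receive the parts, and x becomes an inner node of degree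
    1 + 2. The inclusion of the kernels of the maps is proper, which makes the
    refinement terminate. *)
Lemma partial_decomposition_refine (T : sgraph) (delta : G -> T) x :
  partial_decomposition delta -> 1 < #|[set v | delta v == x]| ->
  exists (T' : sgraph) (delta' : G -> T'),
    partial_decomposition delta' /\
    [set p | delta' p.1 == delta' p.2] \proper [set p | delta p.1 == delta p.2].
Proof.
set F := [set v | _] => -[treeT degT cutT fibT] F2.
have FE v : (v \in F) = (delta v == x) by rewrite inE.
have xcod : x \in codom delta.
  have /card_gt0P[v] : 0 < #|F| by exact: ltnW.
  by rewrite FE => /eqP <-; apply: codom_f.
have [A [A0 AF QA QFA]] := Qsplit (fibT x xcod) F2.
have [/fintype.subsetP AsubF [w wF wA]] := properP AF.
have /set0Pn[a aA] := A0.
(* The fibres are moved in two steps: delta1 sends A to the first new vertex,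
   delta2 sends the rest of F to the second. *)
pose T1 := pendant x; pose T2 := pendant (Some x : T1).
pose delta1 v : T1 := if v \in A then None else Some (delta v).
pose delta2 v : T2 := if v \in F :\: A then None else Some (delta1 v).
have retr1 v : retract (delta1 v) = delta v.
  rewrite /delta1; case: ifP => //= /AsubF.
  by rewrite FE => /eqP.
have retr2 v : retract (delta2 v) = delta1 v.
  rewrite /delta2; case: ifP => //=; rewrite in_setD => /andP[vA].
  by rewrite FE /delta1 (negPf vA) => /eqP->.
have d2N v : (delta2 v == None) = (v \in F :\: A).
  by rewrite /delta2; case: ifP.
have d2SN v : (delta2 v == Some None) = (v \in A).
  rewrite /delta2 /delta1 in_setD; case: (boolP (v \in A)) => //= _.
  by case: (v \in F).
have d2SS v y : (delta2 v == Some (Some y)) = (delta v == y) && (y != x).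
  rewrite /delta2 /delta1 in_setD; case: (boolP (v \in A)) => [/AsubF|_] /=.
    by rewrite FE => /eqP->; rewrite (eq_sym x); case: (y == x).
  rewrite FE; case: (eqVneq (delta v) x) => [->|vx] /=.
    by rewrite (eq_sym x); case: (y == x).
  have -> : (Some (Some (delta v)) == Some (Some y) :> T2) = (delta v == y) by [].
  by case: (eqVneq (delta v) y) => //= <-.
have codE z v : delta2 v == z -> z \in codom delta2.
  by move=> /eqP<-; apply: codom_f.
exists T2, delta2; split; first split.
- by do 2 apply: pendant_tree.
- case=> [[y|]|]; rewrite ?deg_pendant_Some ?deg_pendant_None ?addn0.
  + have -> : (Some y == Some x :> T1) = (y == x) by [].
    rewrite degT; case: (eqVneq y x) => [->|yx].
      rewrite xcod; case: ifP => // /codomP[v /esym/eqP].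
      by rewrite d2SS eqxx andbF.
    rewrite !addn0; congr (if _ then _ else _).
    apply/codomP/codomP => [] [v /esym/eqP vy]; exists v; apply/esym/eqP.
      by rewrite d2SS vy.
    by move: vy; rewrite d2SS => /andP[].
  + by rewrite (codE _ a) // d2SN.
  + by rewrite (codE _ w) // d2N in_setD wA.
- apply: pendant_cuts => //; first exact: pendant_tree.
  + apply: pendant_cuts => //.
    * move=> s s' /cutT; congr (Q _); apply/setP => v.
      by rewrite !inE /= retr2 retr1.
    * congr (Q _): QA; apply/setP => v; rewrite !inE /= retr2 /delta1.
      by case: (v \in A).
  + by congr (Q _): QFA; apply/setP => v; rewrite [RHS]inE d2N.
- case=> [[y|]|] zcod.
  + have /codomP[v /esym/eqP] := zcod; rewrite d2SS => /andP[/eqP vy yx].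
    have : y \in codom delta by rewrite -vy codom_f.
    move/fibT; congr (Q _); apply/setP => u.
    by rewrite [RHS]inE d2SS yx andbT inE.
  + by congr (Q _): QA; apply/setP => u; rewrite [RHS]inE d2SN.
  + by congr (Q _): QFA; apply/setP => u; rewrite [RHS]inE d2N.
- apply/properP; split.
    apply/fintype.subsetP => -[u v]; rewrite !inE /= => /eqP E.
    by rewrite -retr1 -retr2 E retr2 retr1.
  exists (a, w); rewrite !inE /=.
    by move: (AsubF a aA) wF; rewrite !FE => /eqP-> /eqP->.
  rewrite negbT //; apply/negP => /eqP E.
  have := d2SN a; rewrite aA E d2SN => /idP.
  by rewrite (negPf wA).
Qed.

Lemma decomposition_tree_exists v0 :
  Q [set v0] -> 1 < #|G| ->
  exists (T : sgraph) (delta : G -> T), decomposition_tree delta /\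
    forall s t, s -- t -> Q (cut_side delta s t).
Proof.
move=> Qv0 G2; have [T [delta]] := partial_decomposition_start Qv0 G2.
have [n] := ubnP #|[set p | delta p.1 == delta p.2]|.
elim: n => // n IHn in T delta * => /ltnSE le_n part.
have [inj|] := boolP (injectiveb delta).
  have {}inj := injectiveP _ inj; have [treeT degT cutT _] := part.
  have leafE t : is_leaf t = (t \in codom delta).
    by rewrite /is_leaf degT; case: ifP.
  exists T, delta; split=> //; split=> //.
  - by move=> t; rewrite leafE degT => /negPf->.
  - apply/setP => t; rewrite inE leafE.
    apply/imsetP/codomP => [[v _ ->]|[v ->]]; by exists v.
case/injectivePn => u [v uv duv].
have F2 : 1 < #|[set w | delta w == delta u]|.
  by apply/card_gt1P; exists u, v; rewrite !inE -?duv.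
have [T' [delta' [part' lt]]] := partial_decomposition_refine part F2.
exact: IHn (leq_trans (proper_card lt) le_n) part'.
Qed.

End GrowTree.

(** * From tree decompositions to decomposition trees *)

Section CutsFromBags.
Variables (G T : sgraph) (B : T -> {set G}).
Hypothesis tdB : tree_decomp B.

Let treeT : is_tree T. Proof. by case: tdB. Qed.

Definition bag_covered (A : {set G}) := exists t, covers_cut (B t) A.

(** The nodes whose bags contain v form a connected set, so this set cannot
    use an edge at t when v is not in the bag of t. *)
Lemma bags_same_side v t c s s' :
  v \notin B t -> v \in B s -> v \in B s' -> connect (del_edge t c) s s'.
Proof.
case: tdB => _ _ _ conB vt vs vs'; apply: connect_sub (conB v s s' vs vs').
move=> x y /and3P[xy vx vy]; apply: connect1; rewrite del_edgeE xy.
have [xt|_] /= := eqVneq x t; first by rewrite xt (negPf vt) in vx.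
have [yt|_] /= := eqVneq y t; first by rewrite yt (negPf vt) in vy.
by rewrite andbF.
Qed.

(** The nodes whose bags contain v form a connected set with nodes on both
    sides of the bridge from t to c, so it contains this bridge. *)
Lemma bag_crossing v t c s :
  t -- c -> v \in B t -> v \in B s -> connect (del_edge t c) c s -> v \in B c.
Proof.
move=> tc vt vs cs; apply: contraT => vc.
have := bags_same_side t vc vs vt; rewrite connect_del_edgeC => st.
have := connect_trans cs st; rewrite connect_del_edge_sym.
by rewrite (negPf (tree_edge_bridge treeT tc)).
Qed.

(** Walk from a node t whose bag covers the cut of A towards a node whose bag
    contains the vertex a of A. If the bag of t meets A, a single vertex of this
    intersection can be split off, since the bag of t covers both new cuts.
    Otherwise every vertex of A has its bags in one component of T minus t. Let
    A1 consist of those in the component of the next node c, to which a belongs.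
    No edge joins A1 to the rest of A, so if this rest is nonempty, the bag of t
    covers both cuts. If A1 = A, every neighbour of A outside A is in the bag of
    t and shares a bag with A beyond c, so it is in the bag of c: the walk can
    proceed to c. *)
Lemma bag_covered_split_path (A : {set G}) a t p :
  path (@sedge T) t p -> uniq (t :: p) -> a \in A -> a \in B (last t p) ->
  1 < #|A| -> covers_cut (B t) A ->
  exists A1 : {set G},
    [/\ A1 != set0, A1 \proper A, bag_covered A1 & bag_covered (A :\: A1)].
Proof.
move=> + + aA + A2; case: (tdB) => _ _ edgeB _.
elim: p t => [|c p IHp] t tp utp abag cov;
  have [/set0Pn[v]|/negPn/eqP AB0] := boolP (A :&: B t != set0).
1,3: rewrite inE => /andP[vA vt]; exists [set v]; split.
1,5: by apply/set0Pn; exists v; rewrite inE.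
1,4: by rewrite properEcard sub1set vA cards1.
1,3: by exists t => u w; rewrite inE => /eqP->; rewrite vt.
1,2: exists t => u w; rewrite !inE negb_and negbK => /andP[_ uA];
     by case/orP=> [/eqP->|wA uw]; rewrite ?vt ?orbT //; apply: cov.
- by have : a \in A :&: B t; [rewrite inE aA | rewrite AB0 inE].
have notB v : v \in A -> v \notin B t.
  by move=> vA; apply/negP => vB; have : v \in A :&: B t; [rewrite inE vA|rewrite AB0 inE].
move: tp utp => /= /andP[tc cp] /andP[tNcp ucp].
pose A1 := [set v in A | [exists s, connect (del_edge t c) c s && (v \in B s)]].
have A1P v s : v \in A1 -> v \in B s -> connect (del_edge t c) c s.
  rewrite inE => /andP[vA /existsP[s0 /andP[cs0 vs0]]] vs.
  by apply: connect_trans cs0 _; apply: bags_same_side vs0 vs; apply: notB.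
have aA1 : a \in A1.
  rewrite inE aA; apply/existsP; exists (last c p); rewrite abag andbT.
  exact: (path_avoid_del_edge _ cp tNcp).
have A1A : A1 \subset A by apply/fintype.subsetP => v; rewrite inE => /andP[].
have [A1E|A1N] := eqVneq A1 A.
  apply: (IHp c) => // u w uA wA uw.
  have wt : w \in B t by have := cov u w uA wA uw; rewrite (negPf (notB u uA)).
  have [s /andP[us ws]] := edgeB u w uw.
  rewrite (bag_crossing tc wt ws) ?orbT //.
  by apply: A1P us; rewrite A1E.
have sep u w : u \in A1 -> w \in A -> u -- w -> w \in A1.
  move=> uA1 wA uw; have [s /andP[us ws]] := edgeB u w uw.
  by rewrite inE wA; apply/existsP; exists s; rewrite ws (A1P u).
exists A1; split.
- by apply/set0Pn; exists a.
- by rewrite properEneq A1N.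
- exists t => u w uA1 wA1 uw; apply: cov => //; first exact: (fintype.subsetP A1A).
  by apply: contra wA1 => wA; apply: sep uw.
- exists t => u w /setDP[uA uA1]; rewrite in_setD negb_and negbK => + uw.
  case/orP=> [wA1|wA]; last exact: cov uA wA uw.
  by move: uA1; rewrite (sep w u) // sg_sym.
Qed.

Lemma bag_covered_split (A : {set G}) :
  bag_covered A -> 1 < #|A| ->
  exists A1 : {set G},
    [/\ A1 != set0, A1 \proper A, bag_covered A1 & bag_covered (A :\: A1)].
Proof.
move=> [t cov] A2; have /card_gt0P[a aA] : 0 < #|A| by exact: ltnW.
have [r ar] : exists r, a \in B r by case: tdB.
have [p [tp up] pE] := uniq_pathP treeT t r.
by apply: (bag_covered_split_path tp up aA) => //; rewrite pE.
Qed.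

End CutsFromBags.

(** * From decomposition trees to tree decompositions *)

Section BagsFromCuts.
Variables (G T : sgraph) (delta : G -> T).
Hypothesis treeT : is_tree T.

Definition separates (t s : T) (v u : G) :=
  ~~ connect (del_edge t s) (delta v) (delta u).

(** The nodes on the path from v to a neighbour u are described by their edges
    on this path, namely the edges that separate v from u. The first disjunct
    provides a bag for the vertices without neighbours. *)
Definition path_bag (t : T) : {set G} :=
  [set v | (delta v == t) ||
     [exists s, [exists u, [&& t -- s, v -- u & separates t s v u]]]].

Lemma in_path_bag t s v u :
  t -- s -> v -- u -> separates t s v u -> v \in path_bag t.
Proof.
move=> ts vu sep; rewrite inE; apply/orP; right.
by apply/existsP; exists s; apply/existsP; exists u; apply/and3P.
Qed.

Lemma path_bag_self v : v \in path_bag (delta v).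
Proof. by rewrite inE eqxx. Qed.

Lemma separatesC t s v u : separates t s v u = separates s t v u.
Proof. by rewrite /separates connect_del_edgeC. Qed.

Lemma separates_sym t s v u : separates t s v u = separates t s u v.
Proof. by rewrite /separates connect_del_edge_sym. Qed.

(** Each edge of the path from v to a neighbour separates the two, so v is in
    the bags of both its ends. *)
Lemma path_bag_connect_prefix v u p1 p2 :
  v -- u -> path (@sedge T) (delta v) (p1 ++ p2) ->
  uniq (delta v :: p1 ++ p2) -> last (delta v) (p1 ++ p2) = delta u ->
  connect [rel x y | [&& x -- y, v \in path_bag x & v \in path_bag y]]
    (delta v) (last (delta v) p1).
Proof.
move=> vu; elim/last_ind: p1 p2 => [|p1 b IHp] p2; first by rewrite connect0.
rewrite cat_rcons => pp up lp; apply: connect_trans (IHp _ pp up lp) _.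
have sep : separates (last (delta v) p1) b v u.
  rewrite /separates -lp last_cat /=.
  exact: uniq_path_edge_separates pp up.
have ab : last (delta v) p1 -- b.
  by move: pp; rewrite cat_path /= => /and3P[].
rewrite last_rcons; apply: connect1; rewrite /= ab (in_path_bag ab vu sep) /=.
by apply: (in_path_bag (s := last (delta v) p1)) vu _; rewrite 1?sg_sym 1?separatesC.
Qed.

Lemma path_bag_tree_decomp : tree_decomp path_bag.
Proof.
split=> //.
- by move=> v; exists (delta v); apply: path_bag_self.
- move=> u v uv; exists (delta u); rewrite path_bag_self /=.
  have [[|b p] [pp up] lp] := uniq_pathP treeT (delta u) (delta v).
    by rewrite /= in lp; rewrite lp path_bag_self.
  have ub : delta u -- b by case/andP: pp.
  apply: (in_path_bag (u := u) ub); first by rewrite sg_sym.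
  rewrite separates_sym /separates -lp.
  exact: (uniq_path_edge_separates (p1 := [::]) treeT pp up).
- move=> v s t.
  set e := [rel x y | _].
  have esym : connect_sym e.
    apply: sym_connect_sym => x y; rewrite /= sg_sym.
    by rewrite [(v \in path_bag x) && _]andbC.
  suff con r : v \in path_bag r -> connect e (delta v) r.
    by move=> /con vs /con; apply: connect_trans; rewrite esym.
  rewrite inE => /orP[/eqP->|]; first exact: connect0.
  case/existsP => q /existsP[u /and3P[rq vu sep]].
  have [p [pp up] lp] := uniq_pathP treeT (delta v) (delta u).
  have rp : r \in delta v :: p.
    apply: contraR sep => rp; rewrite -lp.
    exact: path_avoid_del_edge.
  case/splitPl: rp pp up lp => p1 p2 <- pp up lp.
  exact: path_bag_connect_prefix vu pp up lp.
Qed.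

(** An edge at t that separates v from its neighbour u has v on one side and u
    on the other, so v lies on the boundary of one of the two sides. *)
Lemma card_path_bag_le t :
  injective delta ->
  #|path_bag t| <= 1 + \sum_(s | t -- s)
    (#|boundary (cut_side delta t s)| + #|boundary (cut_side delta s t)|).
Proof.
move=> inj.
have sub : path_bag t \subset [set v | delta v == t] :|:
    \bigcup_(s | t -- s)
      (boundary (cut_side delta t s) :|: boundary (cut_side delta s t)).
  apply/fintype.subsetP => v; rewrite inE => /orP[vt|]; first by rewrite !inE vt.
  case/existsP => s /existsP[u /and3P[ts vu sep]].
  rewrite in_setU; apply/orP; right; apply/bigcupP; exists s => //.
  have side a b : separates a b v u -> connect (del_edge a b) a (delta v) ->
      v \in boundary (cut_side delta a b).
    move=> abs av; rewrite !inE av; apply/existsP; exists u; rewrite !inE vu andbT.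
    apply: contra abs => au; apply: connect_trans au.
    by rewrite connect_del_edge_sym.
  rewrite in_setU; have [tv|sv] := connect_edge_side treeT t s (delta v).
    by rewrite side.
  by rewrite orbC side 1?separatesC // connect_del_edgeC.
apply: leq_trans (subset_leq_card sub) _.
apply: leq_trans (leq_card_setU _ _) _; apply: leq_add.
  by apply/card_le1_eqP => x y; rewrite !inE => /eqP<- /eqP/inj.
elim/big_ind2: _ => [|a n b p an bp|s _]; first by rewrite cards0.
  by apply: leq_trans (leq_card_setU _ _) _; apply: leq_add.
exact: leq_card_setU.
Qed.

End BagsFromCuts.

(** * Treewidth against boolean-width *)

Lemma tw_le_width (G T : sgraph) (B : T -> {set G}) :
  tree_decomp B -> tw G <= tree_decomp_width B.
Proof.
move=> tdB; rewrite /tw; case: ex_minnP => k _; apply.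
by apply/asboolP; exists T, B.
Qed.

Lemma tw_attained (G : sgraph) : exists (T : sgraph) (B : T -> {set G}),
  tree_decomp B /\ forall t, #|B t| <= (tw G).+1.
Proof.
rewrite /tw; case: ex_minnP => k /asboolP[T [B [tdB <-]]] _.
exists T, B; split=> // t; apply: leq_trans (leqSpred _).
exact: (leq_bigmax (F := fun t => #|B t|)).
Qed.

Section Widths.
Local Open Scope ring_scope.
Variables (R : realType) (G : sgraph).

Lemma boolw_tree_ge0 (T : sgraph) (delta : G -> T) : 0 <= boolw_tree R delta.
Proof.
rewrite /boolw_tree; elim/big_ind: _ => // [x y x0 y0|st _].
  by rewrite le_max x0.
by rewrite -[0]/(0%:R) -log2_exp2; apply: le_log2_nat (card_cut_nbhds_gt0 _).
Qed.

Lemma cutbool_le_boolw_tree (T : sgraph) (delta : G -> T) s t :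
  s -- t -> cutbool R (cut_side delta s t) <= boolw_tree R delta.
Proof.
move=> st; rewrite /boolw_tree.
exact: (le_bigmax_cond _ (fun st => cutbool R (cut_side delta st.1 st.2))
          (j := (s, t))).
Qed.

Lemma tw_le_boolw_tree (T : sgraph) (delta : G -> T) d :
  (forall x : G, deg x <= d)%N -> decomposition_tree delta ->
  (tw G)%:R <= 6 * d%:R ^+ 2 * boolw_tree R delta.
Proof.
move=> degG [treeT deg3 inj _].
set b := boolw_tree R delta.
have b0 : 0 <= b by exact: boolw_tree_ge0.
have [t maxE] : {t | (\max_(t : T) #|path_bag delta t|)%N = #|path_bag delta t|}.
  by case: treeT => T0 _ _; exact: (bigop.eq_bigmax (fun t => #|path_bag delta t|) T0).
have degT : (deg t <= 3)%N.
  by have [/leq_trans->|/deg3->] := boolP (is_leaf t).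
apply: (@le_trans _ _ (\sum_(s | t -- s)
    (#|boundary (cut_side delta t s)| + #|boundary (cut_side delta s t)|))%N%:R).
  rewrite ler_nat; apply: leq_trans (tw_le_width (path_bag_tree_decomp delta treeT)) _.
  by rewrite /tree_decomp_width maxE -subn1 leq_subLR card_path_bag_le.
apply: (@le_trans _ _ (\sum_(s | t -- s) (2 * d%:R ^+ 2 * b))).
  rewrite natr_sum; apply: ler_sum => s ts; rewrite natrD.
  have bd x y : x -- y -> #|boundary (cut_side delta x y)|%:R <= d%:R ^+ 2 * b.
    move=> xy; apply: le_trans (boundary_le_cutbool R _ degG) _.
    by rewrite ler_wpM2l ?exprn_ge0 // cutbool_le_boolw_tree.
  have := bd t s ts; have := bd s t; rewrite sg_sym => /(_ ts); lra.
rewrite sumr_const -[#|_|]/(deg t) -[X in X <= _]mulr_natl.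
have -> : 6 * d%:R ^+ 2 * b = 3%:R * (2 * d%:R ^+ 2 * b) by ring.
by rewrite ler_wpM2r ?ler_nat // !mulr_ge0 ?exprn_ge0.
Qed.

Lemma decomposition_tree_boolw_tree_le :
  (1 < #|G|)%N -> exists (T : sgraph) (delta : G -> T),
    decomposition_tree delta /\ boolw_tree R delta <= (tw G)%:R + 1.
Proof.
move=> G2; have [S [B [tdB Bk]]] := tw_attained G.
have /card_gt0P[v0 _] : (0 < #|G|)%N by exact: ltnW.
have Qv0 : bag_covered B [set v0].
  have [t vt] : exists t, v0 \in B t by case: tdB.
  by exists t => u w; rewrite inE => /eqP-> _ _; rewrite vt.
have QC A : bag_covered B A -> bag_covered B (~: A).
  by case=> t cov; exists t; apply: covers_cutC.
have [T [delta [dec cuts]]] :=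
  decomposition_tree_exists QC (bag_covered_split tdB) Qv0 G2.
exists T, delta; split=> //; rewrite /boolw_tree.
apply: bigmax_le => [|st /cuts[t cov]]; first by rewrite addr_ge0.
by apply: le_trans (cutbool_le_cover R cov) _; rewrite natr1 ler_nat.
Qed.

End Widths.

Local Open Scope ring_scope.

Theorem theorem2 (R : realType) (G : sgraph) (d : nat) :
  (1 <= d)%N -> max_degree G = d ->
  1 / (6 * d%:R ^+ 2) * (tw G)%:R <= boolw R G /\
  boolw R G <= (tw G)%:R + 1.
Proof.
move=> d1 maxd.
have degG (x : G) : (deg x <= d)%N by rewrite -maxd; apply: leq_bigmax.
have G2 : (1 < #|G|)%N.
  have [x] : exists x : G, (0 < deg x)%N.
    apply/existsP; apply: contraLR d1 => /existsPn deg0.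
    by rewrite -maxd -eqn0Ngt; apply/eqP/big1 => x _; apply/eqP; rewrite eqn0Ngt.
  by case/card_gt0P => y xy; apply/card_gt1P; exists x, y; rewrite sedge_neq.
have [T [delta [dec le_tw]]] := decomposition_tree_boolw_tree_le R G2.
have val : boolw_values R G (boolw_tree R delta) by exists T, delta.
have [[T' [delta' [dec' <-]]] min] : boolw_values R G (boolw R G) /\
    forall w, boolw_values R G w -> boolw R G <= w.
  by apply: boolw_attained; exists (boolw_tree R delta).
split.
  rewrite div1r mulrC ler_pdivrMr; last by rewrite mulr_gt0 // exprn_gt0 // ltr0n.
  by rewrite mulrC; apply: tw_le_boolw_tree.
exact: le_trans (min _ val) le_tw.
Qed.
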